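(* There is an infinite-dimensional real Banach space $\mathfrak{X}$ such that for every two-dimensional linear subspace $Z$ of $\mathfrak{X}^*$, the set $Z\cap \operatorname{NA}(\mathfrak{X},\mathbb{R})$ is contained in the union of two one-dimensional linear subspaces (that is, $S_Z\cap \operatorname{NA}(\mathfrak{X},\mathbb{R})$ contains at most four points). Equivalently, given two linearly independent elements $f,g\in\operatorname{NA}(\mathfrak{X},\mathbb{R})$, no element $tf+(1-t)g$ with $0<t<1$ belongs to $\operatorname{NA}(\mathfrak{X},\mathbb{R})$.
   Context: All Banach spaces are real. For a Banach space $X$, $X^*$ is its topological dual with the dual norm and $S_X$ is its unit sphere; $S_Z$ denotes the unit sphere of the subspace $Z$ with the inherited norm. A functional $f\in X^*$ is norm-attaining if there is $x\in S_X$ with $|f(x)|=\|f\|$; $\operatorname{NA}(X,\mathbb{R})$ denotes the set of norm-attaining functionals on $X$. *)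

(* Defs.v *)
From HB Require Import structures.
From mathcomp Require Import all_boot all_order all_algebra.
From mathcomp Require Import all_classical all_reals all_analysis.
Set Implicit Arguments.
Unset Strict Implicit.
Unset Printing Implicit Defensive.
Import Order.TTheory GRing.Theory Num.Theory.
Import numFieldNormedType.Exports.
Local Open Scope classical_set_scope.
Local Open Scope ring_scope.

Section LinearAlgebra.
Context {R : realType} {V : lmodType R}.

Definition lin_indep (n : nat) (e : n.-tuple V) : Prop :=
  forall a : 'I_n -> R, \sum_(i < n) a i *: tnth e i = 0 -> forall i, a i = 0.

Definition lin_span (n : nat) (e : n.-tuple V) : set V :=
  [set v | exists a : 'I_n -> R, v = \sum_(i < n) a i *: tnth e i].

Definition subspace_of_dim (n : nat) (Z : set V) : Prop :=
  exists e : n.-tuple V, lin_indep e /\ Z = lin_span e.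

End LinearAlgebra.

Definition infinite_dimensional (R : realType) (V : lmodType R) : Prop :=
  forall n : nat, ~ subspace_of_dim n [set: V].

Section TopologicalDual.
Context {R : realType} (X : normedModType R).

Definition is_functional : {pred X -> R^o} :=
  fun f => `[< linear f /\ continuous f >].

Lemma is_functional_submod_closed : GRing.submod_closed is_functional.
Proof.
split.
  apply/asboolP; split=> [a u v|x] /=; last exact: cst_continuous.
  by rewrite scaler0 addr0.
move=> a f g /asboolP[fl fc] /asboolP[gl gc]; apply/asboolP; split=> [b u v|x].
  rewrite !fctE /= fl gl !scalerDr !scalerA (mulrC a b) -!addrA; congr (_ + _).
  by rewrite addrCA.
by apply: cvgD; [apply: cvgZl_tmp; exact: fc|exact: gc].
Qed.

HB.instance Definition _ := GRing.isSubmodClosed.Build R (X -> R^o) is_functional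
  is_functional_submod_closed.

Record topdual := Dual {
  dual_fun :> X -> R^o;
  dual_funP : dual_fun \in is_functional }.

HB.instance Definition _ := [isSub for dual_fun].
HB.instance Definition _ := [Choice of topdual by <:].
HB.instance Definition _ := [SubChoice_isSubLmodule of topdual by <:].

Definition dual_norm (f : topdual) : R :=
  sup [set `|f x| | x in [set x : X | `|x| <= 1]].

Definition norm_attaining : set topdual :=
  [set f : topdual | exists x : X, `|x| = 1 /\ `|f x| = dual_norm f].

Definition dual_sphere (Z : set topdual) : set topdual :=
  [set f : topdual | Z f /\ dual_norm f = 1].

End TopologicalDual.

Arguments norm_attaining {R} X _.

(* Main.v *)
(* The space is c_0 renormed by the gauge of {Phi <= 1}, where
     Phi x = sum_n phi (x n) + sum_n 2^-n psi_n (X (2^-(n+1))),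
   X is the power series with coefficients x, phi is a C^1 convex even function
   vanishing exactly on [-1, 1], psi_n v = v^2 for n even and v^4 for n odd.
   The gauge is smooth, so a functional attaining its norm at x is a multiple
   of Phi'(x).  The first sum of Phi'(x) is finitely supported, while the second
   one, viewed at the n-th basis vector, is a power series evaluated at
   2^-(n+1), hence determined by its values for large n.  A linear relation
   between Phi'(x1), Phi'(x2), Phi'(x3) with nonzero coefficients t_i therefore
   forces sum_i t_i psi_n'(X_i (2^-(n+1))) = 0 for every n: even n give
   sum_i t_i X_i = 0, and odd n give sum_i t_i X_i^3 = 0 at infinitely many
   points.  Eliminating X_3 leaves a nonzero homogeneous cubic relation between
   X_1 and X_2, whose ratio thus takes a same value infinitely often near 0.
   So X_1 and X_2 are proportional, and x1 = x2 or x1 = - x2. *)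
Require Import Defs.
From HB Require Import structures.
From mathcomp Require Import all_boot all_order all_algebra.
From mathcomp Require Import all_classical all_reals all_analysis.
From mathcomp Require Import ring lra.
Set Implicit Arguments.
Unset Strict Implicit.
Unset Printing Implicit Defensive.
Import Order.TTheory GRing.Theory Num.Theory.
Import numFieldNormedType.Exports.
Local Open Scope classical_set_scope.
Local Open Scope card_scope.
Local Open Scope ring_scope.

(** * Minkowski gauge of a smooth convex even function and its support functionals *)

Section Gauge.
Context {R : realType} {V : lmodType R}.
Variables (Phi : V -> R) (D : V -> V -> R).
Hypothesis Phi0 : Phi 0 = 0.
Hypothesis PhiN : forall x, Phi (- x) = Phi x.
Hypothesis D_linear : forall x a u v, D x (a *: u + v) = a * D x u + D x v.
Hypothesis Phi_subgradient : forall x y, Phi x + D x (y - x) <= Phi y.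
(** Together with the subgradient inequality, this makes [D x] the directional derivative of [Phi]
    at [x]; [C] may depend on both [x] and [y]. *)
Hypothesis Phi_upper : forall x y, exists C : R, forall t : R, 0 <= t -> t <= 1 ->
  Phi (x + t *: y) <= Phi x + t * D x y + t ^+ 2 * C.

Definition gauge x := inf [set t : R | 0 < t /\ Phi (t^-1 *: x) <= 1].

Lemma DD x u v : D x (u + v) = D x u + D x v.
Proof. by have := D_linear x 1 u v; rewrite scale1r mul1r. Qed.

Lemma D0 x : D x 0 = 0.
Proof. by have := DD x 0 0; rewrite addr0; lra. Qed.

Lemma DZ x a u : D x (a *: u) = a * D x u.
Proof. by have := D_linear x a u 0; rewrite !addr0 D0 addr0. Qed.

(** Average the subgradient inequalities at the intermediate point [z]: the linear terms cancel. *)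
Lemma Phi_convex (t : R) x y : 0 <= t -> t <= 1 ->
  Phi (t *: x + (1 - t) *: y) <= t * Phi x + (1 - t) * Phi y.
Proof.
move=> t0 t1; set z := _ + _.
have : t *: (x - z) + (1 - t) *: (y - z) = 0.
  rewrite !scalerBr addrACA -/z -opprD -scalerDl.
  by rewrite [t + _]addrC subrK scale1r subrr.
move/(congr1 (D z)); rewrite DD !DZ D0 => Dz.
have := Phi_subgradient z x; have := Phi_subgradient z y.
by nra.
Qed.

Lemma Phi_scale (t : R) x : 0 <= t -> t <= 1 -> Phi (t *: x) <= t * Phi x.
Proof.
by move=> t0 t1; have := Phi_convex x 0 t0 t1; rewrite scaler0 addr0 Phi0 mulr0 addr0.
Qed.

Lemma gauge_nonempty x : [set t : R | 0 < t /\ Phi (t^-1 *: x) <= 1] !=set0.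
Proof.
have M1 : 1 <= Num.max 1 (Phi x) by rewrite le_max lexx.
have M0 : 0 < Num.max 1 (Phi x) by apply: lt_le_trans M1.
exists (Num.max 1 (Phi x)); split => //.
apply: le_trans (Phi_scale _ _ _) _; rewrite ?invr_ge0 ?(ltW M0) ?invf_le1//.
by rewrite ler_pdivrMl// mulr1 le_max lexx orbT.
Qed.

Lemma gauge_lbound x : has_lbound [set t : R | 0 < t /\ Phi (t^-1 *: x) <= 1].
Proof. by exists 0 => t /= [/ltW]. Qed.

Lemma gauge_le x (t : R) : 0 < t -> Phi (t^-1 *: x) <= 1 -> gauge x <= t.
Proof. by move=> t0 Pt; apply: ge_inf => //; exact: gauge_lbound. Qed.

Lemma gauge_ge0 x : 0 <= gauge x.
Proof. by apply: lb_le_inf => [|t /= [/ltW]//]; exact: gauge_nonempty. Qed.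

(** Admissible scales are upward closed: some admissible [s] lies below [t], and [Phi_scale] passes
    from [x / s] to its multiple [x / t]. *)
Lemma gauge_lt x (t : R) : gauge x < t -> Phi (t^-1 *: x) <= 1.
Proof.
move=> xt; have t0 : 0 < t := le_lt_trans (gauge_ge0 x) xt.
have [|s /= [s0 Ps] st] := inf_lt _ xt; first exact: gauge_nonempty.
have -> : t^-1 *: x = (s / t) *: (s^-1 *: x).
  by rewrite scalerA mulrAC mulfV ?mul1r// gt_eqF.
have st1 : s / t <= 1 by rewrite ler_pdivrMr// mul1r ltW.
have st0 : 0 <= s / t by rewrite divr_ge0// ltW.
apply: le_trans (Phi_scale _ _ _) _ => //.
by apply: le_trans st1; rewrite ler_piMr.
Qed.

(** The unit ball is exactly the sublevel set. No continuity is invoked: the subgradient at [x]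
    compares [Phi x] with [Phi] at [(1 - e) x], which is at most 1. *)
Lemma gauge_le1 x : gauge x <= 1 -> Phi x <= 1.
Proof.
move=> x1; rewrite leNgt; apply/negP => Px.
have key e : 0 < e -> e < 1 -> Phi x <= 1 + e * D x x.
  move=> e0 e1; have e1' : 0 < 1 - e by rewrite subr_gt0.
  have : gauge x < (1 - e)^-1.
    by apply: le_lt_trans x1 _; rewrite invf_gt1// ltrBlDr ltrDl.
  move/gauge_lt; rewrite invrK => P1.
  have := Phi_subgradient x ((1 - e) *: x).
  move: P1; rewrite scalerBl scale1r addrAC subrr add0r -scaleNr DZ mulNr.
  by lra.
have [Dx|Dx] := leP (D x x) 0.
  by have := key (2^-1); nra.
(* This value of [e] lies in (0, 1) and makes [e * D x x] smaller than [Phi x - 1], contradicting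
   [key]. *)
have h0 : 0 < (Phi x - 1) / (Phi x - 1 + 2 * D x x) by apply: divr_gt0; lra.
have h1 : (Phi x - 1) / (Phi x - 1 + 2 * D x x) < 1.
  by rewrite ltr_pdivrMr; lra.
have := key _ h0 h1; rewrite mulrAC -lerBlDl ler_pdivlMr; last by lra.
by nra.
Qed.

Lemma gauge_triangle x y : gauge (x + y) <= gauge x + gauge y.
Proof.
apply/ler_addgt0Pr => e e0.
have a0 : 0 < gauge x + e / 2 by apply: ltr_wpDl; rewrite ?gauge_ge0// divr_gt0.
have b0 : 0 < gauge y + e / 2 by apply: ltr_wpDl; rewrite ?gauge_ge0// divr_gt0.
have Pa : Phi ((gauge x + e / 2)^-1 *: x) <= 1.
  by apply: gauge_lt; rewrite ltrDl divr_gt0.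
have Pb : Phi ((gauge y + e / 2)^-1 *: y) <= 1.
  by apply: gauge_lt; rewrite ltrDl divr_gt0.
have -> : gauge x + gauge y + e = (gauge x + e / 2) + (gauge y + e / 2) by field.
move: (gauge x + e / 2) (gauge y + e / 2) a0 b0 Pa Pb => a b a0 b0 Pa Pb.
have ab0 : 0 < a + b by exact: addr_gt0.
apply: gauge_le => //.
have -> : (a + b)^-1 *: (x + y) =
    (a / (a + b)) *: (a^-1 *: x) + (1 - a / (a + b)) *: (b^-1 *: y).
  rewrite !scalerA scalerDr; congr (_ *: _ + _ *: _); field; lra.
have t0 : 0 <= a / (a + b) by rewrite divr_ge0// ltW.
have t1 : a / (a + b) <= 1 by rewrite ler_pdivrMr// mul1r lerDl ltW.
by apply: le_trans (Phi_convex _ _ _ _) _ => //; nra.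
Qed.

Lemma gauge0 : gauge 0 = 0.
Proof.
apply/eqP; rewrite eq_le gauge_ge0 andbT.
by apply/ler_addgt0Pr => e e0; rewrite add0r gauge_le// scaler0 Phi0.
Qed.

Lemma gaugeN x : gauge (- x) = gauge x.
Proof.
rewrite /gauge; congr inf; apply/seteqP.
by split=> t /= [t0]; rewrite scalerN PhiN.
Qed.

Lemma gaugeZ_le c x : 0 < c -> gauge (c *: x) <= c * gauge x.
Proof.
move=> c0; apply/ler_addgt0Pr => e e0.
have xe : gauge x < gauge x + e / c by rewrite ltrDl divr_gt0.
have -> : c * gauge x + e = c * (gauge x + e / c).
  by rewrite mulrDr mulrCA mulfV ?mulr1// gt_eqF.
have t0 : 0 < gauge x + e / c := le_lt_trans (gauge_ge0 x) xe.
apply: gauge_le; first exact: mulr_gt0.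
have := gauge_lt xe; congr (Phi _ <= _); rewrite scalerA; congr (_ *: _).
by rewrite invfM mulrAC mulVf ?mul1r// gt_eqF.
Qed.

Lemma gaugeZ c x : gauge (c *: x) = `|c| * gauge x.
Proof.
have pos d y : 0 < d -> gauge (d *: y) = d * gauge y.
  move=> d0; apply/eqP; rewrite eq_le gaugeZ_le//=.
  have := gaugeZ_le (d *: y) (_ : 0 < d^-1).
  rewrite invr_gt0 scalerA mulVf ?gt_eqF// scale1r => /(_ d0).
  by rewrite ler_pdivlMl.
have [c0|c0|->] := ltgtP c 0.
- by rewrite ltr0_norm// -pos ?oppr_gt0// scaleNr gaugeN.
- by rewrite gtr0_norm// pos.
- by rewrite scale0r gauge0 normr0 mul0r.
Qed.

(** For small [t] the negative linear term absorbs the quadratic remainder of [Phi_upper]. *)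
Lemma small_step (d C : R) : d < 0 ->
  exists t : R, [/\ 0 < t, t <= 1 & t * d + t ^+ 2 * C <= 0].
Proof.
move=> d0; have C0 := normr_ge0 C; have CC := ler_norm C.
have s0 : 0 < - d + `|C| by lra.
exists (- d / (- d + `|C|)); split.
- by apply: divr_gt0; lra.
- by rewrite ler_pdivrMr//; lra.
set t := _ / _.
have t0 : 0 < t by apply: divr_gt0; lra.
have tE : t * (- d + `|C|) = - d by rewrite /t divfK// gt_eqF.
have tC : t * C <= t * `|C| by rewrite ler_pM2l.
have : t * (d + t * C) <= 0 by rewrite pmulr_rle0//; nra.
by rewrite mulrDr mulrA expr2.
Qed.

(** Otherwise the subgradient inequality towards 0 gives [Phi x <= 0], and [x] could be stretched
    without leaving the unit ball. *)
Lemma gauge1_D_gt0 x : gauge x = 1 -> 0 < D x x.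
Proof.
move=> x1; rewrite ltNge; apply/negP => Dx.
have [C HC] := Phi_upper x x.
have := Phi_subgradient x 0; rewrite Phi0 sub0r -scaleN1r DZ mulN1r => Px.
(* Slope -1 is chosen so that the remainder [t ^+ 2 * C] is at most [t], hence at most 1. *)
have [|t [t0 t1 tP]] := @small_step (-1) C; first by lra.
have : gauge ((1 + t) *: x) <= 1.
  apply: gauge_le => //; rewrite invr1 scale1r scalerDl scale1r.
  by apply: le_trans (HC _ _ _) _; rewrite ?(ltW t0)//; nra.
by rewrite gaugeZ x1 mulr1 gtr0_norm; lra.
Qed.

(* If [D x y < 0], a small step from [x] along [y] stays in the unit ball, so
   [f y <= 0]; hence the kernel of [D x] is contained in that of [f]. *)
Lemma gauge_support (f : V -> R) (l : R) x :
  (forall a u v, f (a *: u + v) = a * f u + f v) ->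
  gauge x = 1 -> (forall y, f y <= l * gauge y) -> f x = l ->
  forall y, f y = l / D x x * D x y.
Proof.
move=> f_lin x1 fl fx y.
have l0 : 0 <= l.
  have f0 : f 0 = 0 by have := f_lin 1 0 0; rewrite scaler0 add0r mul1r; lra.
  have := fl (- x); rewrite gaugeN x1 mulr1 -scaleN1r.
  by have := f_lin (-1) x 0; rewrite addr0 f0 => ->; lra.
have Dxx := gauge1_D_gt0 x1.
have neg z : D x z < 0 -> f z <= 0.
  move=> Dz; have [C HC] := Phi_upper x z.
  have [t [t0 t1 tP]] := small_step C Dz.
  have Nt : gauge (t *: z + x) <= 1.
    apply: gauge_le => //; rewrite invr1 scale1r addrC.
    apply: le_trans (HC _ _ _) _; rewrite ?(ltW t0)//.
    have : Phi x <= 1 by apply: gauge_le1; rewrite x1.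
    by lra.
  have := fl (t *: z + x); rewrite f_lin fx => ftz.
  have {ftz} : t * f z <= 0 by nra.
  by rewrite pmulr_rle0.
have null z : D x z = 0 -> f z <= 0.
  move=> Dz; apply/ler_addgt0Pr => e e0.
  (* Tilting [z] slightly towards [- x] makes the derivative strictly negative and changes [f] by at
     most [e]; the [+ 1] covers [l = 0]. *)
  have := neg ((- (e / (l + 1))) *: x + z); rewrite D_linear Dz addr0 f_lin fx.
  rewrite mulNr oppr_lt0 => /(_ _) fz.
  have {}fz : - (e / (l + 1)) * l + f z <= 0.
    by apply: fz; rewrite mulr_gt0// divr_gt0//; lra.
  have : e / (l + 1) * l <= e by rewrite mulrAC ler_pdivrMr; nra.
  by lra.
pose c := D x y / D x x.
have Dz : D x ((- c) *: x + y) = 0.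
  by rewrite D_linear mulNr /c divfK ?gt_eqF// addNr.
have fz : f ((- c) *: x + y) = 0.
  apply/eqP; rewrite eq_le null//=.
  have f0 : f 0 = 0 by have := f_lin 1 0 0; rewrite scaler0 add0r mul1r; lra.
  have := null ((-1) *: ((- c) *: x + y)); rewrite DZ Dz mulr0 => /(_ erefl).
  by have := f_lin (-1) ((- c) *: x + y) 0; rewrite addr0 f0 => ->; lra.
move: fz; rewrite f_lin fx /c => /eqP; rewrite mulNr addrC subr_eq0 => /eqP ->.
by field; rewrite gt_eqF.
Qed.

End Gauge.

(** * Power series with bounded coefficients on [0, 1/2] and their zeros near 0 *)

Section PowerSeries.
Context {R : realType}.
Implicit Types (u v : nat -> R) (s : R).

Definition sumR u : R := limn (series u).

Lemma sumR0 : sumR (fun=> 0) = 0.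
Proof.
rewrite /sumR; have -> : series (fun=> 0 : R) = (fun=> 0).
  by apply/funext => n; rewrite /series/= big1.
exact: lim_cst.
Qed.

Lemma cvg_series_lin (a b c : R) u v : series u @ \oo --> b -> series v @ \oo --> c ->
  series (fun n => a * u n + v n) @ \oo --> a * b + c.
Proof.
move=> cu cv; have -> : series (fun n => a * u n + v n) =
    (fun n => a * series u n + series v n).
  by apply/funext => n; rewrite /series/= big_split/= mulr_sumr.
by apply: cvgD => //; exact: cvgMl_tmp.
Qed.

Lemma is_cvg_series_lin (a : R) u v : cvgn (series u) -> cvgn (series v) ->
  cvgn (series (fun n => a * u n + v n)).
Proof. by move=> cu cv; apply/cvg_ex; eexists; exact: cvg_series_lin cu cv. Qed.

Lemma sumR_lin (a : R) u v : cvgn (series u) -> cvgn (series v) ->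
  sumR (fun n => a * u n + v n) = a * sumR u + sumR v.
Proof.
by move=> cu cv; apply: (cvg_lim (@Rhausdorff R)); exact: cvg_series_lin cu cv.
Qed.

Lemma is_cvg_series_eventually0 u N : (forall n, (N <= n)%N -> u n = 0) ->
  cvgn (series u).
Proof.
move=> u0; apply/cvg_ex; exists (series u N); apply: cvg_near_cst.
exists N => // n /= Nn; rewrite -[n](subnK Nn) series_addn.
by rewrite big_nat big1 ?addr0// => k /andP[Nk _]; exact: u0.
Qed.

Lemma term_le_sumR u n : cvgn (series u) -> (forall n, 0 <= u n) ->
  u n <= sumR u.
Proof.
move=> cu u0; apply: le_trans (_ : series u n.+1 <= _).
  by rewrite seriesSr lerDr; exact: sumr_ge0.
by apply: nondecreasing_cvgn_le => //; exact: nondecreasing_series.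
Qed.

Definition bounded_seq u := exists M : R, forall n, `|u n| <= M.

(** The power series with coefficients [u]. The estimates keep [s] in [0, 1/2], where bounded
    coefficients give convergence and the geometric factor 1 / (1 - s) is at most 2. *)
Definition gen u s := sumR (fun n => u n * s ^+ n).

Lemma geometric_bound s (M : R) : 0 <= s -> s <= 2^-1 ->
  cvgn (series (geometric M s)) /\ (0 <= M -> limn (series (geometric M s)) <= M * 2).
Proof.
move=> s0 s2; have s1 : `|s| < 1 by rewrite ger0_norm//; lra.
split=> [|M0]; first exact: is_cvg_geometric_series.
have -> := cvg_lim (@Rhausdorff R) (cvg_geometric_series (a:=M) s1).
by rewrite ler_wpM2l// -[leRHS]invrK lef_pV2 ?posrE; lra.
Qed.

Lemma is_cvg_gen_normed u s : bounded_seq u -> 0 <= s -> s <= 2^-1 ->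
  cvgn [normed series (fun n => u n * s ^+ n)].
Proof.
move=> [M uM] s0 s2; have [cg _] := geometric_bound M s0 s2.
apply: series_le_cvg cg => n //=.
  by rewrite mulr_ge0 ?exprn_ge0//; apply: le_trans (uM n).
by rewrite normrM (ger0_norm (exprn_ge0 _ s0)) ler_wpM2r ?exprn_ge0.
Qed.

Lemma is_cvg_gen u s : bounded_seq u -> 0 <= s -> s <= 2^-1 ->
  cvgn (series (fun n => u n * s ^+ n)).
Proof. by move=> *; apply: normed_cvg; exact: is_cvg_gen_normed. Qed.

Lemma gen_le u s (M : R) : (forall n, `|u n| <= M) -> 0 <= s -> s <= 2^-1 ->
  `|gen u s| <= M * 2.
Proof.
move=> uM s0 s2; have bu : bounded_seq u by exists M.
have cn := is_cvg_gen_normed bu s0 s2.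
have [cg gM] := geometric_bound M s0 s2.
apply: le_trans (lim_series_norm cn) _; apply: le_trans (gM _); last first.
  exact: le_trans (uM 0%N).
apply: lim_series_le => // n /=.
by rewrite normrM (ger0_norm (exprn_ge0 _ s0)) ler_wpM2r ?exprn_ge0.
Qed.

Lemma bounded_seq_lin (a : R) u v : bounded_seq u -> bounded_seq v ->
  bounded_seq (fun n => a * u n + v n).
Proof.
move=> [M uM] [N vN]; exists (`|a| * M + N) => n.
by rewrite (le_trans (ler_normD _ _))// normrM lerD// ler_wpM2l.
Qed.

Lemma gen_lin (a : R) u v s : bounded_seq u -> bounded_seq v ->
  0 <= s -> s <= 2^-1 ->
  gen (fun n => a * u n + v n) s = a * gen u s + gen v s.
Proof.
move=> bu bv s0 s2; rewrite /gen -sumR_lin//; do ?exact: is_cvg_gen.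
by congr sumR; apply/funext => n; rewrite mulrDl mulrA.
Qed.

Lemma gen_mono u v s : bounded_seq u -> bounded_seq v -> 0 <= s -> s <= 2^-1 ->
  (forall n, u n <= v n) -> gen u s <= gen v s.
Proof.
move=> bu bv s0 s2 uv; apply: lim_series_le => [||n]; do ?exact: is_cvg_gen.
by rewrite ler_wpM2r ?exprn_ge0.
Qed.

Lemma gen_rec u s : bounded_seq u -> 0 <= s -> s <= 2^-1 ->
  gen u s = u 0%N + s * gen (fun n => u n.+1) s.
Proof.
move=> bu s0 s2; have bu' : bounded_seq (fun n => u n.+1).
  by case: bu => M uM; exists M.
have cu := is_cvg_gen bu s0 s2; have cu' := is_cvg_gen bu' s0 s2.
apply: (@cvg_unique _ (@Rhausdorff R) (series (fun n => u n * s ^+ n) @ \oo)); first exact: cu.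
rewrite /= -cvg_shiftS.
have -> : (fun n => series (fun n => u n * s ^+ n) n.+1) =
    (fun n => u 0%N + s * series (fun n => u n.+1 * s ^+ n) n).
  apply/funext => n; rewrite /series/= big_nat_recl// expr0 mulr1 mulr_sumr.
  by congr (_ + _); apply: eq_bigr => i _; rewrite exprS mulrCA.
by apply: cvgD; [exact: cvg_cst|apply: cvgMl_tmp].
Qed.

Lemma eq_gen u v s : (forall n, u n = v n) -> gen u s = gen v s.
Proof. by move=> uv; have -> : u = v by exact/funext. Qed.

Lemma gen0 s : gen (fun=> 0) s = 0.
Proof.
rewrite /gen -[RHS]sumR0; congr sumR.
by apply/funext => n; rewrite mul0r.
Qed.

Lemma gen_delta k s : 0 <= s -> s <= 2^-1 ->
  gen (fun n => (n == k)%:R) s = s ^+ k.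
Proof.
move=> s0 s2; have bd m : bounded_seq (fun n => (n == m)%:R).
  by exists 1 => n; rewrite normr_nat; case: (n == m); rewrite ?ler01.
elim: k => [|k IHk]; rewrite gen_rec//=.
  by rewrite (@eq_gen _ (fun=> 0))// gen0 mulr0 addr0.
rewrite add0r exprS -IHk; congr (_ * _); exact: eq_gen.
Qed.

(** Sample points tending to 0; the shift of the exponent keeps even the first one within
    [0, 1/2]. *)
Definition hpow n : R := 2^-1 ^+ n.+1.

Lemma hpow_gt0 n : 0 < hpow n. Proof. by rewrite exprn_gt0. Qed.

Lemma hpow_ge0 n : 0 <= hpow n. Proof. exact/ltW/hpow_gt0. Qed.

Lemma hpow_le n : hpow n <= 2^-1.
Proof. by rewrite /hpow exprS ler_piMr ?exprn_ile1//; lra. Qed.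

Lemma hpow_small (e : R) : 0 < e -> exists N, forall n, (N <= n)%N -> hpow n < e.
Proof.
move=> e0; have h1 : `|2^-1 : R| < 1 by rewrite ger0_norm//; lra.
have /cvgrPdist_lt/(_ _ e0)[N _ HN] := cvg_expr h1.
exists N => n Nn; have := HN n.+1 (leqW Nn).
by rewrite sub0r normrN ger0_norm ?exprn_ge0.
Qed.

Definition infinitely_often (P : nat -> Prop) :=
  forall N, exists2 n, (N <= n)%N & P n.

Lemma infinitely_often_or (P Q : nat -> Prop) :
  infinitely_often (fun n => P n \/ Q n) ->
  infinitely_often P \/ infinitely_often Q.
Proof.
move=> PQ; have [iP|/existsNP[N nP]] := pselect (infinitely_often P).
  by left.
right=> M; have [n] := PQ (maxn N M); rewrite geq_max => /andP[Nn Mn] [Pn|Qn].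
  by case: nP; exists n.
by exists n.
Qed.

(* The zeros accumulate at [0], so the first coefficient is small, hence null;
   then peel it off. *)
Lemma gen_zeros u : bounded_seq u ->
  infinitely_often (fun n => gen u (hpow n) = 0) -> forall n, u n = 0.
Proof.
move=> bu zu n.
have u0 v : bounded_seq v ->
    infinitely_often (fun n => gen v (hpow n) = 0) -> v 0%N = 0.
  move=> [M vM] zv; apply/eqP; rewrite -normr_eq0 eq_le normr_ge0 andbT.
  have M0 : 0 <= M := le_trans (normr_ge0 _) (vM 0%N).
  apply/ler_addgt0Pr => e e0; rewrite add0r.
  have e1 : 0 < e / (M * 2 + 1) by rewrite divr_gt0//; lra.
  have [N HN] := hpow_small e1; have [m Nm] := zv N.
  rewrite gen_rec ?hpow_ge0 ?hpow_le//; last by exists M.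
  move=> /eqP; rewrite addr_eq0 => /eqP ->.
  rewrite normrN normrM (ger0_norm (hpow_ge0 _)).
  have gM : `|gen (fun n => v n.+1) (hpow m)| <= M * 2.
    by apply: gen_le; rewrite ?hpow_ge0 ?hpow_le.
  apply: le_trans (ler_pM _ _ (ltW (HN _ Nm)) gM) _; rewrite ?hpow_ge0//.
  by rewrite mulrAC ler_pdivrMr; nra.
elim: n u bu zu => [|n IHn] u bu zu; first exact: u0.
apply: (IHn (fun n => u n.+1)); first by case: bu => M uM; exists M.
move=> N; have [m Nm um] := zu N; exists m => //.
move: um; rewrite gen_rec ?hpow_ge0 ?hpow_le// u0// add0r => /eqP.
by rewrite mulf_eq0 gt_eqF ?hpow_gt0//= => /eqP.
Qed.

End PowerSeries.

(** * The scalar functions [phi] and [psi]: tangent inequalities and quadratic upper bounds *)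

Section Potentials.
Context {R : realType}.
Implicit Types (s t u v h B : R) (n : nat).

Definition pos_part u : R := Num.max 0 u.

Lemma pos_partE u : pos_part u = if 0 <= u then u else 0.
Proof. by rewrite /pos_part; case: leP. Qed.

(** The squared positive part of |s| - 1, written so that each half is handled by the lemmas on
    [pos_part]; [dphi] is its derivative. *)
Definition phi s := pos_part (s - 1) ^+ 2 + pos_part (- s - 1) ^+ 2.
Definition dphi s := 2 * pos_part (s - 1) - 2 * pos_part (- s - 1).

Lemma phi_ge0 s : 0 <= phi s.
Proof. by rewrite addr_ge0// sqr_ge0. Qed.

Lemma phiN s : phi (- s) = phi s.
Proof. by rewrite /phi opprK addrC. Qed.

Lemma dphiN s : dphi (- s) = - dphi s.
Proof. by rewrite /dphi opprK opprB. Qed.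

Lemma phi_dphi0 s : `|s| <= 1 -> phi s = 0 /\ dphi s = 0.
Proof.
rewrite ler_norml /phi /dphi => /andP[s1 s2].
by rewrite /pos_part !max_l; [rewrite expr0n mulr0 addr0 subr0|lra|lra].
Qed.

Lemma pos_part_le u : u <= pos_part u.
Proof. by rewrite le_max lexx orbT. Qed.

Lemma pos_part_ge0 u : 0 <= pos_part u.
Proof. by rewrite le_max lexx. Qed.

Lemma phi_le1 s : phi s <= 1 -> `|s| <= 2.
Proof.
rewrite ler_norml /phi => p1; have := pos_part_le (s - 1); have := pos_part_le (- s - 1).
have := pos_part_ge0 (s - 1); have := pos_part_ge0 (- s - 1).
have a1 : pos_part (s - 1) <= 1 by nra.
have b1 : pos_part (- s - 1) <= 1 by nra.
by move=> *; apply/andP; split; lra.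
Qed.

Lemma pos_part_mul u : pos_part u * u = pos_part u ^+ 2.
Proof. by rewrite pos_partE; case: leP; rewrite ?mul0r ?expr0n// -expr2. Qed.

(** Write a, b for the positive parts of u, v. Since a u = a^2 and a v <= a b, the claim follows
    from (a - b)^2 >= 0. *)
Lemma pos_part_sub u v : pos_part u ^+ 2 + 2 * pos_part u * (v - u) <= pos_part v ^+ 2.
Proof.
have := pos_part_mul u; have := pos_part_le v; have := pos_part_ge0 u.
have := sqr_ge0 (pos_part u - pos_part v).
move: (pos_part u) (pos_part v) => a b ab a0 bv au.
have : a * v <= a * b by exact: ler_wpM2l.
by nra.
Qed.

(** The right side is (a + h)^2 with a the positive part of u. If b is that of u + h, then b^2 = b
    (u + h) <= b (a + h), and a square concludes. *)
Lemma pos_part_up u h : pos_part (u + h) ^+ 2 <= pos_part u ^+ 2 + 2 * pos_part u * h + h ^+ 2.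
Proof.
have := pos_part_mul (u + h); have := pos_part_le u; have := pos_part_ge0 (u + h).
have := sqr_ge0 (pos_part u + h - pos_part (u + h)).
move: (pos_part u) (pos_part (u + h)) => a b ab b0 ua bu.
have : b * u <= b * a by exact: ler_wpM2l.
by nra.
Qed.

Lemma phi_sub u v : phi u + dphi u * (v - u) <= phi v.
Proof.
have := pos_part_sub (u - 1) (v - 1); have := pos_part_sub (- u - 1) (- v - 1).
by rewrite /phi /dphi; lra.
Qed.

Lemma phi_up u h : phi (u + h) <= phi u + dphi u * h + 2 * h ^+ 2.
Proof.
have := pos_part_up (u - 1) h; have := pos_part_up (- u - 1) (- h).
have -> : u - 1 + h = u + h - 1 by lra.
have -> : - u - 1 - h = - (u + h) - 1 by lra.
by rewrite /phi /dphi; lra.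
Qed.

(** Two exponents alternate so that a relation between derivatives yields both a linear and a cubic
    relation. *)
Definition psi n v : R := if odd n then v ^+ 4 else v ^+ 2.
Definition dpsi n v : R := if odd n then 4 * v ^+ 3 else 2 * v.

Lemma psi_ge0 n v : 0 <= psi n v.
Proof. by rewrite /psi; case: odd; rewrite exprn_even_ge0. Qed.

Lemma psiN n v : psi n (- v) = psi n v.
Proof. by rewrite /psi; case: odd; ring. Qed.

Lemma dpsiN n v : dpsi n (- v) = - dpsi n v.
Proof. by rewrite /dpsi; case: odd; ring. Qed.

Lemma psi_sub n u v : psi n u + dpsi n u * (v - u) <= psi n v.
Proof.
rewrite /psi /dpsi; case: odd; last by have := sqr_ge0 (v - u); lra.
rewrite -subr_ge0.
have -> : v ^+ 4 - (u ^+ 4 + 4 * u ^+ 3 * (v - u)) =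
  (v - u) ^+ 2 * ((v + u) ^+ 2 + 2 * u ^+ 2) by ring.
by apply: mulr_ge0; rewrite ?sqr_ge0// addr_ge0 ?sqr_ge0// mulr_ge0 ?sqr_ge0.
Qed.

Lemma norm_expr_le v B m : `|v| <= B -> `|v ^+ m| <= B ^+ m.
Proof.
by move=> vB; rewrite normrX lerXn2r ?nnegrE//; apply: le_trans vB.
Qed.

Lemma psi_le n v B : `|v| <= B -> `|psi n v| <= B ^+ 2 + B ^+ 4.
Proof.
move=> vB; have B0 : 0 <= B by apply: le_trans vB.
rewrite /psi; case: odd; have := norm_expr_le 4 vB; have := norm_expr_le 2 vB.
  by have := sqr_ge0 B; lra.
by have := exprn_ge0 4 B0; lra.
Qed.

Lemma dpsi_le n v h B : `|v| <= B -> `|h| <= B ->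
  `|dpsi n v * h| <= 2 * B ^+ 2 + 4 * B ^+ 4.
Proof.
move=> vB hB; have B0 : 0 <= B by apply: le_trans vB.
have B2 := exprn_ge0 2 B0; have B4 := exprn_ge0 4 B0.
rewrite /dpsi; case: odd; rewrite -mulrA normrM ger0_norm// normrM.
  have : `|v ^+ 3| * `|h| <= B ^+ 3 * B by rewrite ler_pM// norm_expr_le.
  by rewrite -exprSr; lra.
have : `|v| * `|h| <= B * B by rewrite ler_pM.
by rewrite -expr2; lra.
Qed.

(** One constant serves both parities, hence all [n] at once: the quartic remainder has coefficients
    6 + 4 + 1 = 11, and the quadratic one needs only B^2. *)
Lemma psi_up n v h t B : `|v| <= B -> `|h| <= B -> 0 <= t -> t <= 1 ->
  psi n (v + t * h) <= psi n v + t * (dpsi n v * h) + t ^+ 2 * (B ^+ 2 + 11 * B ^+ 4).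
Proof.
move=> vB hB t0 t1; have B0 : 0 <= B by apply: le_trans vB.
have B2 := exprn_ge0 2 B0; have B4 := exprn_ge0 4 B0.
have t2 := sqr_ge0 t; rewrite -subr_ge0 /psi /dpsi; case: odd.
  have -> : v ^+ 4 + t * (4 * v ^+ 3 * h) + t ^+ 2 * (B ^+ 2 + 11 * B ^+ 4)
      - (v + t * h) ^+ 4 =
    t ^+ 2 * (B ^+ 2 + 11 * B ^+ 4 -
      (6 * (v ^+ 2 * h ^+ 2) + t * (4 * (v * h ^+ 3)) + t ^+ 2 * h ^+ 4)) by ring.
  apply: mulr_ge0 => //.
  have e1 : `|v ^+ 2 * h ^+ 2| <= B ^+ 4.
    by rewrite (exprD B 2 2) normrM ler_pM// norm_expr_le.
  have e2 : `|t * (v * h ^+ 3)| <= B ^+ 4.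
    rewrite normrM (ger0_norm t0) -[leRHS]mul1r ler_pM// normrM (exprS B).
    by rewrite ler_pM// norm_expr_le.
  have e3 : `|t ^+ 2 * h ^+ 4| <= B ^+ 4.
    rewrite normrM -[leRHS]mul1r ler_pM ?norm_expr_le//.
    by rewrite ger0_norm// expr_le1.
  have := ler_norm (v ^+ 2 * h ^+ 2); have := ler_norm (t * (v * h ^+ 3)).
  have := ler_norm (t ^+ 2 * h ^+ 4).
  by lra.
have -> : v ^+ 2 + t * (2 * v * h) + t ^+ 2 * (B ^+ 2 + 11 * B ^+ 4)
    - (v + t * h) ^+ 2 = t ^+ 2 * (B ^+ 2 - h ^+ 2 + 11 * B ^+ 4) by ring.
apply: mulr_ge0 => //; have := norm_expr_le 2 hB.
by have := ler_norm (h ^+ 2); lra.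
Qed.

End Potentials.

(** * The space of null sequences, the function [Phi] and its derivative *)

Section C0.
Context {R : realType}.

Definition vanishing : {pred nat -> R^o} :=
  fun u => `[< (u : nat -> R) @ \oo --> (0 : R) >].

Lemma vanishing_submod_closed : GRing.submod_closed vanishing.
Proof.
split=> [|a u v /asboolP u0 /asboolP v0]; apply/asboolP; first exact: cvg_cst.
have := cvgD (cvgMl_tmp (a := a) u0) v0; rewrite mulr0 addr0; apply.
Qed.

HB.instance Definition _ := GRing.isSubmodClosed.Build R (nat -> R^o) vanishing
  vanishing_submod_closed.

Record c0 := C0 { c0_seq : nat -> R^o; c0_seqP : c0_seq \in vanishing }.

(** Coordinates are retyped from [R^o] to [R], so that they are read as scalars. *)
Definition c0_fun (x : c0) : nat -> R := c0_seq x.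
Coercion c0_fun : c0 >-> Funclass.

HB.instance Definition _ := [isSub for c0_seq].
HB.instance Definition _ := [Choice of c0 by <:].
HB.instance Definition _ := [SubChoice_isSubLmodule of c0 by <:].

Implicit Types (x y z : c0) (n : nat) (t M : R).

Lemma c0_ext x y : (forall n, x n = y n) -> x = y.
Proof. by move=> xy; apply/val_inj/funext. Qed.

Lemma c0_add x y n : (x + y) n = x n + y n. Proof. by []. Qed.
Lemma c0_opp x n : (- x) n = - x n. Proof. by []. Qed.
Lemma c0_scale t x n : (t *: x) n = t * x n. Proof. by []. Qed.
Lemma c0_0 n : (0 : c0) n = 0. Proof. by []. Qed.

Lemma c0_small x t : 0 < t -> exists N, forall n, (N <= n)%N -> `|x n| <= t.
Proof.
move=> t0; have /asboolP/cvgrPdist_le/(_ _ t0)[N _ HN] := c0_seqP x.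
by exists N => n Nn; have := HN n Nn; rewrite sub0r normrN.
Qed.

Lemma c0_bounded x : bounded_seq (x : nat -> R).
Proof.
have [N HN] := @c0_small x 1 ltr01.
exists (1 + \sum_(i < N) `|x i|) => n; have [Nn|nN] := leqP N n.
  by rewrite ler_wpDr ?HN// sumr_ge0.
rewrite (bigD1 (Ordinal nN))//= addrCA ler_wpDr// addr_ge0// sumr_ge0//.
Qed.

Definition delta_fun k : nat -> R^o := fun n => (n == k)%:R.

Lemma delta_vanishing k : delta_fun k \in vanishing.
Proof.
apply/asboolP; apply: cvg_near_cst; exists k.+1 => // n /= kn.
by rewrite /delta_fun gtn_eqF.
Qed.

Definition delta k : c0 := C0 (delta_vanishing k).

Lemma deltaE k n : delta k n = (n == k)%:R. Proof. by []. Qed.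

(** The power series with coefficients [x], sampled at 2^-(n+1). *)
Definition lap x n : R := gen x (hpow n).

Lemma lap_lin t x y n : lap (t *: x + y) n = t * lap x n + lap y n.
Proof.
by rewrite /lap -gen_lin ?hpow_ge0 ?hpow_le//; exact: c0_bounded.
Qed.

Lemma lap_le x M n : (forall k, `|x k| <= M) -> `|lap x n| <= M * 2.
Proof. by move=> xM; rewrite gen_le ?hpow_ge0 ?hpow_le. Qed.

Lemma lap_bounded x : exists2 B : R, 0 <= B & forall n, `|lap x n| <= B.
Proof.
have [M xM] := c0_bounded x; exists (M * 2); last by move=> n; exact: lap_le.
by rewrite mulr_ge0//; apply: le_trans (xM 0%N).
Qed.

Lemma lapN x n : lap (- x) n = - lap x n.
Proof.
have := lap_lin (-1) x 0 n; rewrite scaleN1r addr0 => ->.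
by rewrite /lap [gen 0 _](@gen0 R) addr0 mulN1r.
Qed.

Lemma lap0 n : lap 0 n = 0.
Proof. exact: gen0. Qed.

Lemma lap_delta k n : lap (delta k) n = hpow n ^+ k.
Proof. by rewrite /lap gen_delta ?hpow_ge0 ?hpow_le. Qed.

Let half_ge0 : 0 <= 2^-1 :> R. Proof. by []. Qed.
Let half_le : 2^-1 <= 2^-1 :> R. Proof. by []. Qed.

(** Writing the second sum as [gen] at 1/2 supplies the weights 2^-n. [DPhi] is the termwise
    derivative at [x] in the direction [y]. *)
Definition Phi x : R :=
  sumR (fun n => phi (x n)) + gen (fun n => psi n (lap x n)) 2^-1.

Definition DPhi x y : R :=
  sumR (fun n => dphi (x n) * y n) +
  gen (fun n => dpsi n (lap x n) * lap y n) 2^-1.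

Lemma is_cvg_phi x : cvgn (series (fun n => phi (x n))).
Proof.
have [N HN] := @c0_small x 1 ltr01; apply: (@is_cvg_series_eventually0 _ _ N) => n Nn.
by have [] := phi_dphi0 (HN _ Nn).
Qed.

Lemma is_cvg_dphi x (y : nat -> R) : cvgn (series (fun n => dphi (x n) * y n)).
Proof.
have [N HN] := @c0_small x 1 ltr01; apply: (@is_cvg_series_eventually0 _ _ N) => n Nn.
by have [_ ->] := phi_dphi0 (HN _ Nn); rewrite mul0r.
Qed.

Lemma psi_lap_bounded x : bounded_seq (fun n => psi n (lap x n)).
Proof.
have [B _ HB] := lap_bounded x; exists (B ^+ 2 + B ^+ 4) => n; exact: psi_le.
Qed.

Lemma lap_bounded2 x y : exists B : R, [/\ 0 <= B,
  forall n, `|lap x n| <= B & forall n, `|lap y n| <= B].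
Proof.
have [B B0 HB] := lap_bounded x; have [C C0 HC] := lap_bounded y.
exists (B + C); split=> [|n|n]; first exact: addr_ge0.
  by rewrite (le_trans (HB n))// lerDl.
by rewrite (le_trans (HC n))// lerDr.
Qed.

Lemma dpsi_lap_bounded x y : bounded_seq (fun n => dpsi n (lap x n) * lap y n).
Proof.
have [B [B0 Bx By]] := lap_bounded2 x y.
by exists (2 * B ^+ 2 + 4 * B ^+ 4) => n; exact: dpsi_le.
Qed.

Arguments is_cvg_phi : clear implicits.
Arguments is_cvg_dphi : clear implicits.

#[local] Hint Resolve is_cvg_phi is_cvg_dphi psi_lap_bounded dpsi_lap_bounded : core.

Lemma Phi0 : Phi 0 = 0.
Proof.
have p0 : phi 0 = 0 :> R by have [] := @phi_dphi0 R 0; rewrite ?normr0.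
rewrite /Phi (@eq_gen R _ (fun=> 0)) => [|n]; last first.
  by rewrite lap0 /psi; case: odd; rewrite expr0n.
rewrite gen0 addr0.
have -> : (fun n => phi ((0 : c0) n)) = (fun=> 0 : R).
  by apply/funext => n; rewrite c0_0 p0.
exact: sumR0.
Qed.

Lemma PhiN x : Phi (- x) = Phi x.
Proof.
rewrite /Phi; congr (_ + _).
  by congr (sumR); apply/funext => n; rewrite c0_opp phiN.
by apply: eq_gen => n; rewrite lapN psiN.
Qed.

Lemma DPhi_linear x t y z : DPhi x (t *: y + z) = t * DPhi x y + DPhi x z.
Proof.
rewrite /DPhi mulrDr addrACA -sumR_lin//.
rewrite -gen_lin//; congr (_ + _).
  by congr (sumR); apply/funext => n; rewrite c0_add c0_scale; ring.
by apply: eq_gen => n; rewrite lap_lin; ring.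
Qed.

Lemma DPhiN x y : DPhi (- x) y = - DPhi x y.
Proof.
have -> : - DPhi x y = DPhi x (- y).
  have := DPhi_linear x (-1) y 0; have := DPhi_linear x 1 0 0.
  by rewrite scale1r !addr0 scaleN1r => h0 ->; lra.
rewrite /DPhi; congr (_ + _).
  by congr (sumR); apply/funext => n; rewrite !c0_opp dphiN; ring.
by apply: eq_gen => n; rewrite !lapN dpsiN; ring.
Qed.

Lemma Phi_sub x y : Phi x + DPhi x (y - x) <= Phi y.
Proof.
rewrite /Phi /DPhi addrACA lerD//.
  rewrite addrC -[X in X + _]mul1r -sumR_lin ?is_cvg_phi//.
  apply: lim_series_le => [||n]; first exact: is_cvg_series_lin.
    exact: is_cvg_phi.
  by have := phi_sub (x n) (y n); rewrite c0_add c0_opp; lra.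
rewrite addrC -[X in X + _]mul1r -gen_lin//.
apply: gen_mono => //; first exact: bounded_seq_lin.
move=> n; have := psi_sub n (lap x n) (lap y n).
have := lap_lin 1 y (- x) n; rewrite lapN scale1r => ->; lra.
Qed.

(** The [psi] part has a remainder bounded uniformly in [n], summable against 2^-n. The [phi] part
    contributes finitely many terms: far out, both [x n] and [y n] are at most 1/2 in absolute
    value, so [x n + t * y n] stays where [phi] vanishes. *)
Lemma Phi_up x y : exists C : R, forall t, 0 <= t -> t <= 1 ->
  Phi (x + t *: y) <= Phi x + t * DPhi x y + t ^+ 2 * C.
Proof.
have [B [B0 Bx By]] := lap_bounded2 x y.
have h2 : (0 : R) < 2^-1 by [].
have [N1 HN1] := c0_small x h2; have [N2 HN2] := c0_small y h2.
pose N := maxn N1 N2.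
(* The remainder of [phi_up] for the step [t * y n], without its factor [t ^+ 2], cut off at [N]. *)
pose e n : R := if (n < N)%N then 2 * y n ^+ 2 else 0.
have ce : cvgn (series e).
  by apply: (@is_cvg_series_eventually0 _ _ N) => n Nn; rewrite /e ltnNge Nn.
pose K := B ^+ 2 + 11 * B ^+ 4.
have bK : bounded_seq (fun=> K) by exists `|K|.
exists (sumR e + gen (fun=> K) 2^-1) => t t0 t1.
have -> : Phi x + t * DPhi x y + t ^+ 2 * (sumR e + gen (fun=> K) 2^-1) =
  (t ^+ 2 * sumR e + (t * sumR (fun n => dphi (x n) * y n) +
     sumR (fun n => phi (x n)))) +
  (t ^+ 2 * gen (fun=> K) 2^-1 +
     (t * gen (fun n => dpsi n (lap x n) * lap y n) 2^-1 +
     gen (fun n => psi n (lap x n)) 2^-1)).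
  by rewrite /Phi /DPhi; ring.
have cxy := is_cvg_series_lin (a := t) (is_cvg_dphi x y) (is_cvg_phi x).
have bxy := bounded_seq_lin t (dpsi_lap_bounded x y) (psi_lap_bounded x).
rewrite /Phi lerD//.
  rewrite -(sumR_lin t (is_cvg_dphi x y) (is_cvg_phi x)) -sumR_lin//.
  apply: lim_series_le => [||n]; [exact: is_cvg_phi|exact: is_cvg_series_lin|].
  rewrite /e c0_add c0_scale; case: ifPn => [_|].
    by have := phi_up (x n) (t * y n); lra.
  rewrite -leqNgt geq_max => /andP[/HN1 x1 /HN2 y1].
  have xy1 : `|x n + t * y n| <= 1.
    rewrite (le_trans (ler_normD _ _))// normrM (ger0_norm t0).
    have : t * `|y n| <= 1 * 2^-1 by rewrite ler_pM.
    by lra.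
  have x1' : `|x n| <= 1 by lra.
  by have [-> _] := phi_dphi0 xy1; have [-> ->] := phi_dphi0 x1'; rewrite !(mul0r,mulr0,addr0).
rewrite -(gen_lin t (dpsi_lap_bounded x y) (psi_lap_bounded x))// -gen_lin//.
apply: gen_mono => //; first exact: bounded_seq_lin.
move=> n; have := psi_up n (Bx n) (By n) t0 t1.
have := lap_lin t y x n; rewrite addrC => ->; rewrite -/K [t * _ + lap x n]addrC; lra.
Qed.

(** * The gauge norm and its equivalence with the supremum norm *)

Definition c0_norm : c0 -> R := gauge Phi.

Lemma Phi_le1 x n : Phi x <= 1 -> `|x n| <= 2.
Proof.
move=> Px; apply: phi_le1.
have := term_le_sumR n (is_cvg_phi x) (fun n => phi_ge0 _).
suff : 0 <= gen (fun n => psi n (lap x n)) 2^-1 by move: Px; rewrite /Phi; lra.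
rewrite -(gen0 2^-1); apply: gen_mono => //; last by move=> k; exact: psi_ge0.
  by exists 0 => k; rewrite normr0.
Qed.

Lemma Phi_ball x : (forall n, `|x n| <= 4^-1) -> Phi x <= 1.
Proof.
move=> x4.
have -> : Phi x = gen (fun n => psi n (lap x n)) 2^-1.
  rewrite /Phi; have -> : (fun n => phi (x n)) = (fun=> 0 : R).
    apply/funext => n; have [] := @phi_dphi0 R (x n) => //.
    by apply: le_trans (x4 n) _; lra.
  by rewrite sumR0 add0r.
(* Here |lap x n| <= 1/2, and 1/4 + 1/16 <= 1/2; summing against 2^-n at most doubles this bound. *)
have h n : `|psi n (lap x n)| <= 2^-1.
  have := lap_le n x4 => l4; have l2 : `|lap x n| <= 2^-1 by lra.
  by have := psi_le n l2; lra.
by have := gen_le h half_ge0 half_le; rewrite ler_norml => /andP[_]; lra.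
Qed.

Lemma norm_le_c0_norm x n : `|x n| <= 2 * c0_norm x.
Proof.
apply/ler_addgt0Pr => e e0.
have lt : gauge Phi x < c0_norm x + e / 2 by rewrite ltrDl divr_gt0.
have := gauge_lt Phi0 DPhi_linear Phi_sub lt => /(Phi_le1 n).
have t0 : 0 < c0_norm x + e / 2 := le_lt_trans (gauge_ge0 Phi0 DPhi_linear Phi_sub x) lt.
by rewrite c0_scale normrM normfV (gtr0_norm t0) ler_pdivrMl//; lra.
Qed.

Lemma c0_norm_le x M : 0 < M -> (forall n, `|x n| <= M) -> c0_norm x <= 4 * M.
Proof.
move=> M0 xM; have M4 : 0 < 4 * M by lra.
apply: gauge_le => //; apply: Phi_ball => n.
rewrite c0_scale normrM normfV (gtr0_norm M4) ler_pdivrMl//.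
by apply: le_trans (xM n) _; lra.
Qed.

Lemma c0_normD x y : c0_norm (x + y) <= c0_norm x + c0_norm y.
Proof. exact: gauge_triangle Phi0 DPhi_linear Phi_sub x y. Qed.

Lemma c0_normZ t x : c0_norm (t *: x) = `|t| * c0_norm x.
Proof. exact: gaugeZ Phi0 PhiN DPhi_linear Phi_sub t x. Qed.

Lemma c0_norm0_eq0 x : c0_norm x = 0 -> x = 0.
Proof.
move=> x0; apply: c0_ext => n; apply/eqP.
by have := norm_le_c0_norm x n; rewrite x0 mulr0 normr_le0.
Qed.

HB.instance Definition _ := Lmodule_isNormed.Build R c0 c0_normD c0_normZ c0_norm0_eq0.

End C0.
Arguments c0 : clear implicits.

(** * Completeness of the renormed space *)

Section C0Complete.
Context {R : realType}.

Lemma c0_normE (x : c0 R) : `|x| = c0_norm x.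
Proof. by []. Qed.

(** Coordinates converge because the norm dominates each of them. The resulting sequence tends to 0
    by uniform approximation, and the supremum bound turns coordinatewise closeness into norm
    closeness. *)
Lemma c0_complete (F : set_system (c0 R)) : ProperFilter F -> cauchy F -> cvg F.
Proof.
move=> FF /cauchyP Fc.
have near_ball (e : R) : 0 < e -> exists x0, \forall x \near F, `|x0 - x| < e.
  by move=> e0; have [x0 Fx0] := Fc e e0; exists x0; rewrite -ball_normE in Fx0.
have coord_cvg n : cvg ((fun x : c0 R => x n : R) @ F).
  apply: cauchy_cvg; apply/cauchyP => e e0.
  have [x0 Fx0] := @near_ball (e / 2) ltac:(by rewrite divr_gt0).
  exists (x0 n); rewrite -ball_normE; apply: (@filterS _ F _ _ _ _ Fx0) => x /= x0x.
  by have := norm_le_c0_norm (x0 - x) n; rewrite -c0_normE c0_add c0_opp; lra.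
pose l n := lim ((fun x : c0 R => x n : R) @ F).
have lP (e : R) x0 n : 0 < e -> (\forall x \near F, `|x0 - x| < e) -> `|l n - x0 n| <= 2 * e.
  move=> e0 Fx0; apply/ler_addgt0Pr => d d0; near F => x.
  have lx : `|l n - x n| < d.
    by near: x; apply: (cvgrPdist_lt _ _).1 => //; exact: coord_cvg.
  have := norm_le_c0_norm (x0 - x) n; rewrite -c0_normE c0_add c0_opp distrC.
  have : `|x0 - x| < e by near: x.
  by have := ler_distD (x n) (l n) (x0 n); lra.
have l_van : (l : nat -> R^o) \in vanishing.
  apply/asboolP/cvgrPdist_le => e e0; have e8 : 0 < e / 4 by rewrite divr_gt0.
  have [x0 Fx0] := near_ball _ e8; have [N HN] := c0_small x0 e8.
  exists N => // n /= Nn; rewrite sub0r normrN.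
  have := lP _ x0 n e8 Fx0; have := HN n Nn.
  by have := ler_normD (l n - x0 n) (x0 n); rewrite subrK; lra.
apply/cvg_ex; exists (C0 l_van); apply/cvgrPdist_le => e e0.
(* The limit and [x] each differ from [x0] by at most e/8 in every coordinate, hence from one
   another by e/4; [c0_norm_le] costs a factor 4. *)
have e16 : 0 < e / 16 by rewrite divr_gt0.
have [x0 Fx0] := near_ball _ e16; near=> x.
have x0x : `|x0 - x| < e / 16 by near: x.
rewrite c0_normE; apply: le_trans (@c0_norm_le _ _ (e / 4) _ _) _; last by lra.
  by rewrite divr_gt0.
move=> n; rewrite c0_add c0_opp.
have := norm_le_c0_norm (x0 - x) n; rewrite -c0_normE c0_add c0_opp.
have := lP _ x0 n e16 Fx0; have := ler_distD (x0 n) (l n) (x n).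
by rewrite /(C0 _ n); lra.
Unshelve. all: by end_near. Qed.

HB.instance Definition _ := Uniform_isComplete.Build (c0 R) c0_complete.

End C0Complete.

(** * Bounded functionals and the dual norm *)

Section DualNorm.
Context {R : realType} (X : normedModType R).
Implicit Types f g : topdual X.

Lemma topdual_linear f : linear f.
Proof. by have /asboolP[] := dual_funP f. Qed.

Lemma topdual_ext f g : (forall x, f x = g x) -> f = g.
Proof. by move=> fg; apply/val_inj/funext. Qed.

Lemma topdual_comb (a b : R) f g x :
  (a *: f + b *: g) x = (a : R) * f x + (b : R) * g x :> R.
Proof. by []. Qed.

Lemma topdual_0 x : (0 : topdual X) x = 0 :> R.
Proof. by []. Qed.

(** Ensures that [dual_norm] is the supremum of a bounded set and not a default value. *)
Lemma topdual_bounded f : exists r, forall x, `|f x| <= r * `|x|.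
Proof.
have /asboolP[fl fc] := dual_funP f.
pose g : {linear X -> R^o} := HB.pack (f : X -> R^o) (GRing.isLinear.Build _ _ _ _ _ fl).
have /linear_boundedP : bounded_near g (nbhs 0).
  by apply: continuous_linear_bounded; exact: fc.
by move=> /pinfty_ex_gt0[r _ Hr]; exists r.
Qed.

Lemma topdualZ f (a : R) x : f (a *: x) = a * f x.
Proof.
have := topdual_linear f a x 0; have := topdual_linear f 1 0 0.
by rewrite scaler0 !addr0 scale1r -[X in X = _]addr0 => /addrI <-; rewrite addr0.
Qed.

Lemma dual_norm_ub f x : `|x| <= 1 -> `|f x| <= dual_norm f.
Proof.
have [r Hr] := topdual_bounded f.
move=> x1; apply: ub_le_sup; last by exists x.
exists `|r| => _ /= [z z1 <-]; apply: le_trans (Hr z) _.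
rewrite -[leRHS]mulr1; apply: le_trans (_ : `|r| * `|z| <= _).
  by rewrite ler_wpM2r// ler_norm.
by rewrite ler_wpM2l.
Qed.

Lemma le_dual_norm f x : `|f x| <= dual_norm f * `|x|.
Proof.
have [->|x0] := eqVneq x 0.
  by rewrite -(scale0r 0) topdualZ mul0r scale0r !normr0 mulr0.
have nx : 0 < `|x| by rewrite normr_gt0.
have := @dual_norm_ub f (`|x|^-1 *: x).
rewrite topdualZ !normrM normrZ normfV normr_id mulVf ?gt_eqF// => /(_ (lexx _)).
by rewrite ler_pdivrMl// mulrC.
Qed.

Lemma dual_norm_ge0 f : 0 <= dual_norm f.
Proof. by apply: le_trans (@dual_norm_ub f 0 _) => //; rewrite normr0. Qed.

Lemma dual_norm_le f (M : R) :
  (forall x, `|x| <= 1 -> `|f x| <= M) -> dual_norm f <= M.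
Proof.
move=> fM; apply: ge_sup; last by move=> _ [x x1 <-]; exact: fM.
by exists (`|f 0|); exists 0 => //=; rewrite normr0.
Qed.

Lemma dual_normZ (c : R) f : dual_norm (c *: f) = `|c| * dual_norm f.
Proof.
have le (d : R) (g : topdual X) : dual_norm (d *: g) <= `|d| * dual_norm g.
  apply: dual_norm_le => x x1; rewrite [(d *: g) x]/(d * g x) normrM ler_wpM2l//.
  exact: dual_norm_ub.
apply/eqP; rewrite eq_le le /=; have [->|c0] := eqVneq c 0.
  by rewrite normr0 mul0r dual_norm_ge0.
have := le c^-1 (c *: f); rewrite scalerA mulVf// scale1r normfV.
by rewrite ler_pdivlMl// normr_gt0.
Qed.

End DualNorm.

(** * Cubic relations force a ratio to repeat *)

Section RepeatedRatio.
Context {R : realType}.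

(** Pigeonhole over finitely many roots, by induction on the size: after splitting off the root
    [r n0], either that value recurs or the quotient is hit infinitely often. *)
Lemma repeated_root (p : {poly R}) (r : nat -> R) : p != 0 ->
  infinitely_often (fun n => root p (r n)) ->
  exists c, infinitely_often (fun n => r n = c).
Proof.
elim: {p}(size p) {-2}p (leqnn (size p)) => [|m IHm] p sp p0 rp.
  by move: sp; rewrite leqn0 size_poly_eq0 (negPf p0).
have [n0 _ r0] := rp 0%N; have /factor_theorem[q pq] := r0.
have q0 : q != 0 by apply: contraNneq p0 => q0; rewrite pq q0 mul0r.
have : infinitely_often (fun n => root q (r n) \/ r n = r n0).
  move=> N; have [n Nn rn] := rp N; exists n => //.
  by move: rn; rewrite pq rootM root_XsubC => /orP[|/eqP]; [left|right].
case/infinitely_often_or => [rq|]; last by exists (r n0).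
apply: (IHm q) => //; move: sp.
by rewrite pq size_Mmonic ?monicXsubC// size_XsubC addn2.
Qed.

(* The cubic form [k1 a^3 + k2 b^3 - k3 (a + b)^3] does not vanish identically
   because of its mixed coefficients [- 3 k3]. *)
Lemma repeated_ratio (a b : nat -> R) (k1 k2 k3 : R) : k3 != 0 ->
  (exists N, forall n, (N <= n)%N -> b n != 0) ->
  infinitely_often (fun n =>
    k1 * a n ^+ 3 + k2 * b n ^+ 3 = k3 * (a n + b n) ^+ 3) ->
  exists c, infinitely_often (fun n => a n = c * b n).
Proof.
move=> k30 [N bN] kab.
(* The cubic form divided by b^3, in the variable a / b; its coefficient of degree 1 is - 3 k3. *)
pose p : {poly R} := k1 *: 'X^3 + k2%:P - k3 *: ('X + 1) ^+ 3.
have p0 : p != 0.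
  apply: contraNneq k30 => /(congr1 (fun q : {poly R} => q`_1)).
  rewrite /p.
  have -> : ('X + 1 : {poly R}) ^+ 3 = 'X^3 + 3%:R *: 'X^2 + 3%:R *: 'X + 1.
    by rewrite !scaler_nat; ring.
  by rewrite !coefE/= => e; apply/eqP; lra.
have [|c hc] := @repeated_root p (fun n => a n / b n) p0.
  move=> M; have [n] := kab (maxn N M).
  rewrite geq_max => /andP[Nn Mn] e; exists n => //.
  have bn := bN n Nn; apply/rootP.
  have -> : p.[a n / b n] = k1 * (a n / b n) ^+ 3 + k2 - k3 * (a n / b n + 1) ^+ 3.
    by rewrite /p !hornerE.
  have -> : k1 * (a n / b n) ^+ 3 + k2 - k3 * (a n / b n + 1) ^+ 3 =
    (k1 * a n ^+ 3 + k2 * b n ^+ 3 - k3 * (a n + b n) ^+ 3) / b n ^+ 3 by field.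
  by rewrite e subrr mul0r.
exists c => M; have [n] := hc (maxn N M).
rewrite geq_max => /andP[Nn Mn] e; exists n => //.
by rewrite -e divfK// bN.
Qed.

End RepeatedRatio.

(** * Linear relations between derivatives of [Phi] *)

Section Core.
Context {R : realType}.
Implicit Types (x y z : c0 R) (n k : nat).

Lemma sumRZ (c : R) (u : nat -> R) : cvgn (series u) ->
  sumR (fun n => c * u n) = c * sumR u.
Proof.
move=> cu; have c00 : cvgn (series (fun=> 0 : R)).
  by apply: (@is_cvg_series_eventually0 _ _ 0).
rewrite -[RHS]addr0 -sumR0 -sumR_lin//; congr sumR.
by apply/funext => n; rewrite addr0.
Qed.

Lemma dpsi_bounded x : bounded_seq (fun n => dpsi n (lap x n)).
Proof.
have [B B0 HB] := lap_bounded x.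
exists (2 * (B + 1) ^+ 2 + 4 * (B + 1) ^+ 4) => n.
rewrite -[dpsi _ _]mulr1; apply: dpsi_le; last by rewrite normr1 lerDr.
by apply: le_trans (HB n) _; rewrite lerDl.
Qed.

(** Once |x k| <= 1 the [phi] part vanishes. In the other part the roles of [n] and [k] are
    exchanged, via n + (n+1) k = k + (k+1) n, giving a power series in [hpow k]. *)
Lemma DPhi_delta x : exists N, forall k, (N <= k)%N ->
  DPhi x (delta k) = 2^-1 ^+ k * gen (fun n => dpsi n (lap x n)) (hpow k).
Proof.
have [N HN] := c0_small x (@ltr01 R); exists N => k Nk.
rewrite /DPhi; have -> : (fun n => dphi (x n) * delta k n) = (fun=> 0).
  apply/funext => n; rewrite deltaE.
  case: eqVneq => [->|_]; last by rewrite mulr0.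
  by have [_ ->] := phi_dphi0 (HN _ Nk); rewrite mul0r.
rewrite sumR0 add0r /gen -sumRZ; last first.
  by apply: is_cvg_gen; rewrite ?hpow_ge0 ?hpow_le//; exact: dpsi_bounded.
congr sumR; apply/funext => n; rewrite lap_delta mulrCA -mulrA; congr (_ * _).
by rewrite /hpow -!exprM -!exprD; congr (_ ^+ _); ring.
Qed.

(** Tested on [delta k] for all large [k], the relation says that one power series vanishes at
    [hpow k]; by [gen_zeros] all its coefficients are zero. *)
Lemma DPhi_independent (t1 t2 t3 : R) x1 x2 x3 :
  (forall y, t1 * DPhi x1 y + t2 * DPhi x2 y + t3 * DPhi x3 y = 0) ->
  forall n, t1 * dpsi n (lap x1 n) + t2 * dpsi n (lap x2 n) + t3 * dpsi n (lap x3 n) = 0.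
Proof.
(* The trailing 0 gives the innermost term the shape [a * u n + v n] used by the linearity
   lemmas. *)
move=> D0; have b3 : bounded_seq (fun n => t3 * dpsi n (lap x3 n) + 0).
  by apply: bounded_seq_lin; [exact: dpsi_bounded|exists 0 => n; rewrite normr0].
have b2 := bounded_seq_lin t2 (dpsi_bounded x2) b3.
have b1 := bounded_seq_lin t1 (dpsi_bounded x1) b2.
have b0 : bounded_seq (fun=> 0 : R) by exists 0 => n; rewrite normr0.
have [N1 H1] := DPhi_delta x1; have [N2 H2] := DPhi_delta x2.
have [N3 H3] := DPhi_delta x3.
suff w0 : forall n, t1 * dpsi n (lap x1 n) + (t2 * dpsi n (lap x2 n) +
    (t3 * dpsi n (lap x3 n) + 0)) = 0.
  by move=> n; rewrite -[RHS](w0 n); ring.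
apply: gen_zeros => // N; exists (maxn N (maxn N1 (maxn N2 N3))).
  exact: leq_maxl.
set k := maxn _ _.
have k1 : (N1 <= k)%N by rewrite /k !leq_max leqnn !orbT.
have k2 : (N2 <= k)%N by rewrite /k !leq_max leqnn !orbT.
have k3 : (N3 <= k)%N by rewrite /k !leq_max leqnn !orbT.
have := D0 (delta k); rewrite H1// H2// H3//.
rewrite !gen_lin ?hpow_ge0 ?hpow_le//; do ?exact: dpsi_bounded.
rewrite gen0; set g1 := gen _ _; set g2 := gen _ _; set g3 := gen _ _ => e.
apply: (@mulfI _ (2^-1 ^+ k)); first by rewrite expf_neq0// invr_eq0.
by rewrite mulr0 -[RHS]e; ring.
Qed.

Lemma lap_frequently0 x : infinitely_often (fun n => lap x n = 0) -> x = 0.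
Proof.
by move=> h; apply: c0_ext => n; exact: (gen_zeros (c0_bounded x) h).
Qed.

Lemma lap_eventually_neq0 x : x != 0 -> exists N, forall n, (N <= n)%N -> lap x n != 0.
Proof.
move=> x0; apply: contrapT => h; move/eqP: x0; apply; apply: lap_frequently0 => N.
apply: contrapT => h'; apply: h; exists N => n Nn; apply/eqP => xn.
by apply: h'; exists n.
Qed.

Lemma lapZ (t : R) x n : lap (t *: x) n = t * lap x n.
Proof. by have := lap_lin t x 0 n; rewrite addr0 lap0 addr0. Qed.

Lemma DPhi_dependent (t1 t2 t3 : R) x1 x2 x3 :
  t1 != 0 -> t2 != 0 -> t3 != 0 -> `|x1| = 1 -> `|x2| = 1 ->
  (forall y, t1 * DPhi x1 y + t2 * DPhi x2 y + t3 * DPhi x3 y = 0) ->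
  x1 = x2 \/ x1 = - x2.
Proof.
move=> t10 t20 t30 n1 n2 /DPhi_independent w0.
have lin n : t1 * lap x1 n + t2 * lap x2 n + t3 * lap x3 n = 0.
  suff z0 : t1 *: x1 + (t2 *: x2 + t3 *: x3) = 0.
    by have := lap_lin t1 x1 (t2 *: x2 + t3 *: x3) n; rewrite z0 lap0 lap_lin lapZ; lra.
  (* Even indices give the linear relation; vanishing there already forces the vector itself to be
     0, hence the relation at every index. *)
  apply: lap_frequently0 => N; exists N.*2; first by rewrite -addnn leq_addl.
  have := w0 N.*2; rewrite /dpsi odd_double lap_lin lap_lin lapZ; lra.
have cub n : odd n ->
    t1 * lap x1 n ^+ 3 + t2 * lap x2 n ^+ 3 + t3 * lap x3 n ^+ 3 = 0.
  by move=> on; have := w0 n; rewrite /dpsi on; lra.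
have x20 : x2 != 0 by rewrite -normr_eq0 n2 oner_eq0.
(* With a = t1 X1 and b = t2 X2 the linear relation reads t3 X3 = - (a + b); since t_i X_i^3 =
   t_i^-2 (t_i X_i)^3, the cubic coefficients are t_i^-2. *)
have [|||c hc] := @repeated_ratio R (fun n => t1 * lap x1 n) (fun n => t2 * lap x2 n)
    (t1^-1 ^+ 2) (t2^-1 ^+ 2) (t3^-1 ^+ 2).
- by rewrite expf_neq0// invr_eq0.
- have [N HN] := lap_eventually_neq0 x20; exists N => n Nn.
  by rewrite mulf_neq0// HN.
- move=> N; exists N.*2.+1; first by rewrite -addnn -addnS leq_addr.
  set n := N.*2.+1; have on : odd n by rewrite /= odd_double.
  have := cub n on; have := lin n.
  move: (lap x1 n) (lap x2 n) (lap x3 n) => a b d e1 e2.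
  have -> : t1 * a + t2 * b = - (t3 * d) by lra.
  have -> : t1^-1 ^+ 2 * (t1 * a) ^+ 3 + t2^-1 ^+ 2 * (t2 * b) ^+ 3 =
    t1 * a ^+ 3 + t2 * b ^+ 3 by field; apply/andP.
  have -> : t3^-1 ^+ 2 * (- (t3 * d)) ^+ 3 = - (t3 * d ^+ 3) by field.
  by lra.
(* The repeated ratio [c] gives infinitely many zeros of the power series of this combination. *)
have x12 : t1 *: x1 + (- (c * t2)) *: x2 = 0.
  apply: lap_frequently0 => N; have [n Nn e] := hc N; exists n => //.
  by rewrite lap_lin lapZ e; ring.
pose s := c * t2 / t1.
have xs : x1 = s *: x2.
  move/eqP: x12; rewrite scaleNr subr_eq0 => /eqP/(congr1 (fun z => t1^-1 *: z)).
  by rewrite !scalerA mulVf// scale1r => ->; congr (_ *: _); rewrite /s mulrC.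
have : `|s| = 1 by move: n1; rewrite xs normrZ n2 mulr1.
move/eqP; rewrite eqr_norml ler01 andbT => /orP[]/eqP s1; rewrite xs s1.
  by left; rewrite scale1r.
by right; rewrite scaleN1r.
Qed.

(** Smoothness of the gauge, applied after a change of sign of the point so that [f] itself, not its
    absolute value, reaches the norm. *)
Lemma norm_attaining_support (f : topdual (c0 R)) : norm_attaining (c0 R) f ->
  exists x m, `|x| = 1 /\ forall y, f y = m * DPhi x y.
Proof.
move=> [x0 [x1 fx0]].
have [x [nx fx]] : exists x, `|x| = 1 /\ f x = dual_norm f.
  have [f0|f0] := leP 0 (f x0).
    by exists x0; rewrite -fx0 ger0_norm.
  exists (- x0); rewrite normrN -fx0 ltr0_norm//; split => //.
  by rewrite -scaleN1r topdualZ mulN1r.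
exists x, (dual_norm f / DPhi x x); split=> // y.
apply: (gauge_support Phi0 (@PhiN R) DPhi_linear (@Phi_sub R) (@Phi_up R)) => //.
- by move=> a u v; exact: topdual_linear.
- by move=> z; apply: le_trans (le_dual_norm f z); exact: ler_norm.
Qed.

End Core.

(** * Coordinates in two-dimensional subspaces *)

Section Planes.
Context {R : realType} {V : lmodType R}.
Implicit Types (f g h : V) (Z : set V).

Definition indep2 f g := forall a b : R, a *: f + b *: g = 0 -> a = 0 /\ b = 0.

Lemma lin_indep2 f g : lin_indep [tuple f; g] -> indep2 f g.
Proof.
move=> fg a b ab0; have := fg (fun i => if i == ord0 then a else b).
rewrite !big_ord_recl big_ord0 addr0 /= => /(_ ab0) c0.
by have := c0 ord0; have := c0 (lift ord0 ord0).
Qed.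

Lemma indep2_neq0 f g : indep2 f g -> f != 0 /\ g != 0.
Proof.
move=> fg; split; apply/negP => /eqP h0.
  have [] := fg 1 0; first by rewrite h0 scaler0 scale0r addr0.
  by move/eqP; rewrite oner_eq0.
have [] := fg 0 1; first by rewrite h0 scaler0 scale0r addr0.
by move=> _ /eqP; rewrite oner_eq0.
Qed.

Lemma indep2_notin f g : f != 0 -> (forall c, g <> c *: f) -> indep2 f g.
Proof.
move=> f0 gf a b ab0; have [b0|b0] := eqVneq b 0.
  move: ab0; rewrite b0 scale0r addr0 => /eqP.
  by rewrite scaler_eq0 (negPf f0) orbF => /eqP.
case: (gf (- (b^-1 * a))).
move/(congr1 (fun z => b^-1 *: z)): ab0.
rewrite scaler0 scalerDr !scalerA mulVf// scale1r addrC => /eqP.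
by rewrite addr_eq0 scaleNr => /eqP.
Qed.

Lemma line_dim1 f : f != 0 -> subspace_of_dim 1 [set h | exists c : R, h = c *: f].
Proof.
move=> f0; exists [tuple f]; split.
  move=> a; rewrite big_ord1 /= => /eqP; rewrite scaler_eq0 (negPf f0) orbF => /eqP a0 i.
  by rewrite ord1.
apply/seteqP; split=> h /=.
  by move=> [c ->]; exists (fun=> c); rewrite big_ord1.
by move=> [a ->]; exists (a ord0); rewrite big_ord1.
Qed.

Lemma plane_basis Z : subspace_of_dim 2 Z -> exists f g,
  [/\ indep2 f g, Z f & forall h, Z h <-> exists a b : R, h = a *: f + b *: g].
Proof.
move=> [e [ei ->]]; exists (tnth e ord0), (tnth e (lift ord0 ord0)).
have spanP h : lin_span e h <->
    exists a b : R, h = a *: tnth e ord0 + b *: tnth e (lift ord0 ord0).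
  split=> [[a ->]|[a [b ->]]].
    exists (a ord0), (a (lift ord0 ord0)).
    by rewrite !big_ord_recl big_ord0 addr0.
  exists (fun i => if i == ord0 then a else b).
  by rewrite !big_ord_recl big_ord0 addr0.
split=> //.
- move=> a b ab0; have := ei (fun i => if i == ord0 then a else b).
  rewrite !big_ord_recl big_ord0 addr0 /= => /(_ ab0) c0.
  by have := c0 ord0; have := c0 (lift ord0 ord0).
- by apply/spanP; exists 1, 0; rewrite scale1r scale0r addr0.
Qed.

(** Cramer's rule in the basis [e1], [e2]. *)
Lemma plane_coords Z f g h : subspace_of_dim 2 Z -> Z f -> Z g -> Z h ->
  indep2 f g -> exists a b : R, h = a *: f + b *: g.
Proof.
move=> /plane_basis[e1 [e2 [ei _ ZP]]] /ZP[p [q fE]] /ZP[r [s gE]] /ZP[u [w hE]] fg.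
have combE (a b : R) : a *: f + b *: g = (a * p + b * r) *: e1 + (a * q + b * s) *: e2.
  by rewrite fE gE !scalerDr !scalerA addrACA -!scalerDl.
(* Were the determinant zero, s f - q g and - r f + p g would both vanish, so independence would
   make all four coordinates zero and thus f = 0. *)
have d0 : p * s - q * r != 0.
  apply/negP => /eqP d0.
  have [s0 q0] : s = 0 /\ - q = 0.
    by apply: fg; rewrite combE -[RHS](addr0 0); congr (_ + _);
      apply/eqP; rewrite scaler_eq0; apply/orP; left; apply/eqP; lra.
  have [r0 p0] : - r = 0 /\ p = 0.
    by apply: fg; rewrite combE -[RHS](addr0 0); congr (_ + _);
      apply/eqP; rewrite scaler_eq0; apply/orP; left; apply/eqP; lra.
  have [/negP[]] := indep2_neq0 fg.
  by rewrite fE p0 (_ : q = 0) ?scale0r ?addr0//; lra.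
exists ((u * s - w * r) / (p * s - q * r)), ((p * w - q * u) / (p * s - q * r)).
by rewrite combE hE; congr (_ *: _ + _ *: _); field.
Qed.

End Planes.

(** * Infinite dimension, and norm-attaining functionals in a plane *)

Section Segments.
Context {R : realType}.
Implicit Types f g h : topdual (c0 R).

Lemma c0_infinite_dimensional : infinite_dimensional (c0 R).
Proof.
move=> n [e [_ eT]].
have /choice[A HA] (i : 'I_n.+1) : exists a : 'I_n -> R,
    delta i = \sum_(j < n) a j *: tnth e j.
  by have : lin_span e (delta i) by rewrite -eT.
pose M := \matrix_(i < n.+1, j < n) A i j.
(* A matrix with n+1 rows and n columns has dependent rows; the dependence carries over to the unit
   vectors [delta i], and reading coordinate [k] refutes it. *)
have : kermx M != 0.
  by rewrite kermx_eq0 /row_free neq_ltn ltnS rank_leq_col.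
case/rowV0Pn => v /sub_kermxP vM; case/eqP; apply/rowP => k.
have v0 : \sum_(i < n.+1) v 0 i *: delta i = 0 :> c0 R.
  under eq_bigr => i _ do rewrite HA scaler_sumr.
  rewrite exchange_big big1//= => j _.
  under eq_bigr => i _ do rewrite scalerA.
  rewrite -scaler_suml; have /rowP/(_ j) := vM; rewrite !mxE => e0.
  by under eq_bigr => i _ do rewrite -[A i j](mxE matrix_key); rewrite e0 scale0r.
have sumE (s : seq 'I_n.+1) (F : 'I_n.+1 -> c0 R) m :
    (\sum_(i <- s) F i) m = \sum_(i <- s) F i m.
  by elim/big_rec2: _ => // i y x _ <-.
move/(congr1 (fun z : c0 R => z k)): v0; rewrite sumE (bigD1 k)// big1 => [|i ik].
  by rewrite -[X in X = _ -> _]/((v 0 k *: delta k) k + 0) addr0 c0_scale deltaE eqxx mulr1 mxE.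
by rewrite c0_scale deltaE eq_sym (inj_eq val_inj) (negPf ik) mulr0.
Qed.

(** The three functionals are multiples of [DPhi] at unit vectors, so their relation is one between
    derivatives with nonzero coefficients. [DPhi_dependent] then gives x1 = x2 or x1 = - x2, which
    makes [f] and [g] proportional. *)
Lemma comb_not_norm_attaining f g (a b : R) :
  norm_attaining (c0 R) f -> norm_attaining (c0 R) g -> indep2 f g ->
  a != 0 -> b != 0 -> ~ norm_attaining (c0 R) (a *: f + b *: g).
Proof.
move=> /norm_attaining_support[x1 [m1 [n1 f1]]].
move=> /norm_attaining_support[x2 [m2 [n2 f2]]] fg a0 b0.
move=> /norm_attaining_support[x3 [m3 [n3 f3]]].
have zeroP h (x : c0 R) (m : R) : (forall y, h y = m * DPhi x y) -> h <> 0 -> m != 0.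
  move=> hE h0; apply/negP => /eqP m0; apply: h0; apply: topdual_ext => y.
  by rewrite hE m0 mul0r.
have [/eqP f0 /eqP g0] := indep2_neq0 fg.
have m10 := zeroP _ _ _ f1 f0; have m20 := zeroP _ _ _ f2 g0.
have m30 : m3 != 0.
  by apply: zeroP f3 _ => /fg[/eqP]; rewrite (negPf a0).
have [||||||e|e] := @DPhi_dependent R (a * m1) (b * m2) (- m3) x1 x2 x3.
- by rewrite mulf_neq0.
- by rewrite mulf_neq0.
- by rewrite oppr_eq0.
- by [].
- by [].
- move=> y; have : (a *: f + b *: g) y = m3 * DPhi x3 y := f3 y.
  by rewrite topdual_comb f1 f2 mulrA mulrA => ->; rewrite mulNr subrr.
- have [] := fg m2 (- m1); last by move=> /eqP; rewrite (negPf m20).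
  apply: topdual_ext => y; rewrite topdual_comb topdual_0 f1 f2 e.
  by ring.
- have [] := fg m2 m1; last by move=> /eqP; rewrite (negPf m20).
  apply: topdual_ext => y; rewrite topdual_comb topdual_0 f1 f2 e DPhiN.
  by ring.
Qed.

(** Take a nonzero norm-attaining [f] in [Z] and another one off its line. If the first is missing,
    any line of [Z] serves; if the second is, the line of [f] is used twice. *)
Lemma plane_norm_attaining (Z : set (topdual (c0 R))) : subspace_of_dim 2 Z ->
  exists f g, [/\ f != 0, g != 0 & forall h, Z h -> norm_attaining (c0 R) h ->
    (exists c : R, h = c *: f) \/ (exists c : R, h = c *: g)].
Proof.
move=> Z2; have [e1 [e2 [ei _ _]]] := plane_basis Z2.
have [e10 _] := indep2_neq0 ei.
have [[f [Zf NAf f0]]|nof] :=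
    pselect (exists f, [/\ Z f, norm_attaining (c0 R) f & f != 0]); last first.
  exists e1, e1; split=> // h Zh NAh; left; exists 0; rewrite scale0r.
  by apply/eqP; apply: contrapT => /negP h0; apply: nof; exists h.
have [[g [Zg NAg gf]]|nog] := pselect (exists g, [/\ Z g, norm_attaining (c0 R) g &
    forall c : R, g <> c *: f]); last first.
  exists f, f; split=> // h Zh NAh; left; apply: contrapT => nh.
  by apply: nog; exists h; split=> // c hc; apply: nh; exists c.
have fg := indep2_notin f0 gf; have [_ g0] := indep2_neq0 fg.
exists f, g; split=> // h Zh NAh.
have [a [b hE]] := plane_coords Z2 Zf Zg Zh fg.
have [a0|a0] := eqVneq a 0; first by right; exists b; rewrite hE a0 scale0r add0r.
have [b0|b0] := eqVneq b 0; first by left; exists a; rewrite hE b0 scale0r addr0.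
by have := comb_not_norm_attaining NAf NAg fg a0 b0; rewrite -hE.
Qed.

Lemma dual_sphere_line f (c : R) : dual_norm (c *: f) = 1 ->
  c *: f = (dual_norm f)^-1 *: f \/ c *: f = - (dual_norm f)^-1 *: f.
Proof.
rewrite dual_normZ => cf.
have f0 : dual_norm f != 0.
  by apply/negP => /eqP f0; move/eqP: cf; rewrite f0 mulr0 eq_sym oner_eq0.
have : `|c| = (dual_norm f)^-1 by apply: (mulIf f0); rewrite cf mulVf.
move/eqP; rewrite eqr_norml => /andP[/orP[]/eqP-> _]; [by left|by right].
Qed.

End Segments.

Theorem theorem1 (R : realType) :
  exists X : completeNormedModType R,
    [/\ infinite_dimensional X,
        forall Z : set (topdual X), subspace_of_dim 2 Z ->
          (exists L1 L2 : set (topdual X),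
             [/\ subspace_of_dim 1 L1, subspace_of_dim 1 L2 &
                 Z `&` norm_attaining X `<=` L1 `|` L2])
          /\ dual_sphere Z `&` norm_attaining X #<= `I_4
      & forall f g : topdual X,
          norm_attaining X f -> norm_attaining X g -> lin_indep [tuple f; g] ->
          forall t : R, 0 < t -> t < 1 ->
            ~ norm_attaining X (t *: f + (1 - t) *: g)].
Proof.
exists (c0 R); split; first exact: c0_infinite_dimensional.
  move=> Z /plane_norm_attaining[f [g [f0 g0 Zfg]]]; split.
    exists [set h | exists c : R, h = c *: f], [set h | exists c : R, h = c *: g].
    by split; [exact: line_dim1|exact: line_dim1|move=> h [Zh NAh]; exact: Zfg].
  pose s := [:: (dual_norm f)^-1 *: f; - (dual_norm f)^-1 *: f;
                (dual_norm g)^-1 *: g; - (dual_norm g)^-1 *: g].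
  (* The set is covered by the image of four indices, which tolerates coincidences among the listed
     points. *)
  apply: card_le_trans (card_image_le (nth 0 s) `I_4); apply: subset_card_le.
  move=> h [[Zh h1] NAh]; case: (Zfg h Zh NAh) => -[c hc]; move: h1; rewrite hc.
    by move=> /dual_sphere_line[]->; [exists 0%N|exists 1%N].
  by move=> /dual_sphere_line[]->; [exists 2%N|exists 3%N].
move=> f g NAf NAg /lin_indep2 fg t t0 t1.
by apply: comb_not_norm_attaining; rewrite ?gt_eqF// subr_gt0.
Qed.
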